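(* Let $d\ge1$, let $g$ be a (nondegenerate) Gaussian probability density on $\mathbb{R}^d$, and let $V:\mathbb{R}^d\to(0,\infty)$ be of class $C^{1,1}_{\mathrm{loc}}$, bounded from below by a positive constant, with $\int_{\mathbb{R}^d}V^{-d}=1$. Assume there exists $A>0$ such that \[ \frac{|\nabla V(x)|}{V(x)}\le\frac{A}{1+|x|}\qquad\text{for all }x\in\mathbb{R}^d. \] Then the monotone transport $T$ from $V^{-d}$ to $g$ satisfies \[ |T(x)|\le C\sqrt{1+\log(1+|x|)}\qquad\text{for all }x\in\mathbb{R}^d, \] for some constant $C>0$ depending only on the data. *)

(* Defs.v *)
From HB Require Import structures.
From mathcomp Require Import all_boot all_order all_algebra.
From mathcomp Require Import all_classical all_reals all_analysis.
Set Implicit Arguments. Unset Strict Implicit. Unset Printing Implicit Defensive.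
Import Order.TTheory GRing.Theory Num.Theory.
Import numFieldNormedType.Exports.
Local Open Scope ring_scope.
Local Open Scope classical_set_scope.

Section Defs.
Variable R : realType.

Definition enorm (d : nat) (x : 'rV[R]_d) : R := Num.sqrt (\sum_(i < d) x ord0 i ^+ 2).

Definition grad (d : nat) (f : 'rV[R]_d -> R) (x : 'rV[R]_d) : 'rV[R]_d :=
  \row_(i < d) 'D_(delta_mx ord0 i) f x.

(* Lebesgue integral over R^d of a nonnegative extended-real function, computed
   as the iterated one-dimensional Lebesgue integral (Tonelli). *)
Fixpoint iint (d : nat) : ('rV[R]_d -> \bar R) -> \bar R :=
  match d with
  | 0 => fun f => f 0
  | d'.+1 => fun f =>
      (\int[@lebesgue_measure R]_(t in [set: R])
          iint (fun y : 'rV[R]_d' => f (row_mx (const_mx t : 'rV[R]_1) y)))%E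
  end.

Definition convex_fun (d : nat) (phi : 'rV[R]_d -> R) : Prop :=
  forall (x y : 'rV[R]_d) (l : R), 0 <= l <= 1 ->
    phi (l *: x + (1 - l) *: y) <= l * phi x + (1 - l) * phi y.

Definition C11loc (d : nat) (f : 'rV[R]_d -> R) : Prop :=
  (forall x, differentiable f x) /\
  (forall r : R, 0 < r -> exists L : R, forall x y : 'rV[R]_d,
      enorm x <= r -> enorm y <= r ->
      enorm (grad f x - grad f y) <= L * enorm (x - y)).

Definition spd (d : nat) (S : 'M[R]_d) : Prop :=
  S^T = S /\ forall v : 'rV[R]_d, v != 0 -> 0 < (v *m S *m v^T) ord0 ord0.

Definition gauss_density (d : nat) (m : 'rV[R]_d) (S : 'M[R]_d) (x : 'rV[R]_d) : R :=
  (Num.sqrt ((2 * pi) ^+ d * \det S))^-1 *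
  expR (- (((x - m) *m invmx S *m (x - m)^T) ord0 ord0) / 2).

Definition is_gaussian_density (d : nat) (g : 'rV[R]_d -> R) : Prop :=
  exists (m : 'rV[R]_d) (S : 'M[R]_d), spd S /\ g = gauss_density m S.

Definition pushes_forward (d : nat) (T : 'rV[R]_d -> 'rV[R]_d) (f h : 'rV[R]_d -> R) : Prop :=
  forall u : 'rV[R]_d -> R, continuous u -> (forall y, 0 <= u y) ->
    (exists M : R, forall y, u y <= M) ->
    iint (fun x => (u (T x) * f x)%:E) = iint (fun y => (u y * h y)%:E).

Definition monotone_transport (d : nat) (T : 'rV[R]_d -> 'rV[R]_d) (f h : 'rV[R]_d -> R) : Prop :=
  (exists phi : 'rV[R]_d -> R, convex_fun phi /\ (forall x, differentiable phi x) /\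
     forall x, T x = grad phi x) /\
  pushes_forward T f h.

End Defs.

(* Main.v *)
Require Import Defs.
From HB Require Import structures.
From mathcomp Require Import all_boot all_order all_algebra.
From mathcomp Require Import all_classical all_reals all_analysis.
From mathcomp Require Import measurable_realfun ring lra.
Import Order.TTheory GRing.Theory Num.Theory.
Import numFieldNormedType.Exports.
Local Open Scope ring_scope.

(* The logarithmic gradient bound makes V grow at most polynomially, so V^-d is
   at least a negative power of 1 + |x|.  If M = |T x| > 0, monotonicity of T
   forces |T| >= M / 2 on a cube of fixed size centred at x + T x / M.  Testing
   the transport condition on a truncation of exp (a |z|^2), whose integral
   against the Gaussian is finite for small a, then bounds exp (a M^2 / 4) by a
   constant times a power of 1 + |x|; take logarithms. *)

(** * Iterated integrals of nonnegative functions *)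

(* [ge0_le_integral] would ask for measurability of the iterated integrals;
   comparing the suprema over simple functions avoids it. *)
Lemma le_integralT {R : realType} (f g : R -> \bar R) :
  (forall t, 0 <= f t)%E -> (forall t, f t <= g t)%E ->
  (\int[@lebesgue_measure R]_(t in [set: R]) f t <=
   \int[@lebesgue_measure R]_(t in [set: R]) g t)%E.
Proof.
move=> f0 fg; have g0 t : (0 <= g t)%E by exact: le_trans (f0 t) (fg t).
rewrite !ge0_integralTE//; apply: ge_ereal_sup => _ [h /= hf <-].
by apply: ereal_sup_ubound; exists h => //= t; exact: le_trans (hf t) (fg t).
Qed.

Lemma iint_ge0 {R : realType} {d : nat} (f : 'rV[R]_d -> \bar R) :
  (forall x, 0 <= f x)%E -> (0 <= iint f)%E.
Proof.
elim: d f => [|d IH] f f0 //=.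
by apply: integral_ge0 => t _; apply: IH.
Qed.

Lemma le_iint {R : realType} {d : nat} (f g : 'rV[R]_d -> \bar R) :
  (forall x, 0 <= f x)%E -> (forall x, f x <= g x)%E ->
  (iint f <= iint g)%E.
Proof.
elim: d f g => [|d IH] f g f0 fg //=.
apply: le_integralT => t; first exact: iint_ge0.
exact: IH.
Qed.

(** Tonelli for a product of one-variable functions, used for Gaussian densities and for indicators
    of cubes. The constant [c] makes the induction go through: it absorbs the factor of the first
    coordinate once that is fixed. *)
Lemma iint_prod {R : realType} {d : nat} (p : 'I_d -> R -> R) (q : 'I_d -> R)
    (c : R) :
  0 <= c -> (forall i t, 0 <= p i t) ->
  (forall i, measurable_fun [set: R] (p i)) ->
  (forall i, \int[@lebesgue_measure R]_t (p i t)%:E = (q i)%:E)%E ->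
  iint (fun x : 'rV[R]_d => (c * \prod_i p i (x ord0 i))%:E) =
  (c * \prod_i q i)%:E.
Proof.
elim: d p q c => [|d IH] p q c c0 p0 mp pq /=; first by rewrite !big_ord0.
rewrite [in RHS]big_ord_recl.
have E t : iint (fun y : 'rV[R]_d => (c * \prod_i p i
      ((row_mx (const_mx t : 'rV[R]_1) y) ord0 i))%:E) =
    ((c * \prod_i q (lift ord0 i))%:E * (p ord0 t)%:E)%E.
  rewrite -EFinM mulrAC -(IH (fun i => p (lift ord0 i))) ?mulr_ge0//.
  congr iint; apply/funext => y; congr EFin.
  rewrite big_ord_recl mulrA; congr (_ * p _ _ * _).
    rewrite (_ : ord0 = lshift d (ord0 : 'I_1)) ?row_mxEl ?mxE//; exact: val_inj.
  apply: eq_bigr => i _; congr (p _ _).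
  rewrite (_ : lift ord0 i = rshift 1 i) ?row_mxEr//; exact: val_inj.
under eq_integral do rewrite E.
rewrite ge0_integralZl//= ?pq.
- by rewrite -EFinM; congr EFin; rewrite -mulrA; congr (_ * _); exact: mulrC.
- by apply/measurable_EFinP; exact: mp.
- by move=> t _; rewrite lee_fin.
- rewrite lee_fin mulr_ge0// prodr_ge0// => i _.
  rewrite -lee_fin -pq; apply: integral_ge0 => t _; by rewrite lee_fin.
Qed.

(** * Euclidean inner product and norm *)

Definition dot {R : realType} {d : nat} (u v : 'rV[R]_d) : R :=
  \sum_i u ord0 i * v ord0 i.

Lemma dotC {R : realType} {d : nat} (u v : 'rV[R]_d) : dot u v = dot v u.
Proof. by apply: eq_bigr => i _; rewrite mulrC. Qed.

Lemma dotDl {R : realType} {d : nat} (u v w : 'rV[R]_d) :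
  dot (u + v) w = dot u w + dot v w.
Proof. by rewrite -big_split; apply: eq_bigr => i _; rewrite mxE mulrDl. Qed.

Lemma dotZl {R : realType} {d : nat} (a : R) (u w : 'rV[R]_d) :
  dot (a *: u) w = a * dot u w.
Proof. by rewrite mulr_sumr; apply: eq_bigr => i _; rewrite mxE mulrA. Qed.

Lemma dot0l {R : realType} {d : nat} (w : 'rV[R]_d) : dot 0 w = 0.
Proof. by rewrite -(scale0r w) dotZl mul0r. Qed.

Lemma dotNl {R : realType} {d : nat} (u w : 'rV[R]_d) : dot (- u) w = - dot u w.
Proof. by rewrite -scaleN1r dotZl mulN1r. Qed.

Lemma dotDr {R : realType} {d : nat} (u v w : 'rV[R]_d) :
  dot u (v + w) = dot u v + dot u w.
Proof. by rewrite !(dotC u) dotDl. Qed.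

Lemma dotZr {R : realType} {d : nat} (a : R) (u w : 'rV[R]_d) :
  dot u (a *: w) = a * dot u w.
Proof. by rewrite !(dotC u) dotZl. Qed.

Lemma dotNr {R : realType} {d : nat} (u w : 'rV[R]_d) : dot u (- w) = - dot u w.
Proof. by rewrite !(dotC u) dotNl. Qed.

Lemma dot_mx {R : realType} {d : nat} (u v : 'rV[R]_d) :
  dot u v = (u *m v^T) ord0 ord0.
Proof. by rewrite mxE; apply: eq_bigr => i _; rewrite mxE. Qed.

Lemma enorm_ge0 {R : realType} {d : nat} (u : 'rV[R]_d) : 0 <= enorm u.
Proof. exact: sqrtr_ge0. Qed.

Lemma dotvv {R : realType} {d : nat} (u : 'rV[R]_d) : dot u u = enorm u ^+ 2.
Proof.
rewrite sqr_sqrtr; first by apply: eq_bigr => i _; rewrite expr2.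
by apply: sumr_ge0 => i _; exact: sqr_ge0.
Qed.

Lemma enorm0_eq0 {R : realType} {d : nat} (u : 'rV[R]_d) : enorm u = 0 -> u = 0.
Proof.
move=> u0; apply/rowP => i; rewrite mxE; apply/eqP.
have : \sum_j u ord0 j ^+ 2 == 0.
  by rewrite -[X in X == _]/(\sum_j u ord0 j * u ord0 j) -[X in X == _]/(dot u u)
    dotvv u0 expr0n.
rewrite psumr_eq0 => [/allP/(_ i)|j _]; last exact: sqr_ge0.
by rewrite mem_index_enum sqrf_eq0 => /(_ isT).
Qed.

(** Cauchy-Schwarz: expand the square of the norm of [enorm v *: u - enorm u *: v] and divide by
    [enorm u * enorm v]; a vanishing norm is treated apart. *)
Lemma dot_le_enorm {R : realType} {d : nat} (u v : 'rV[R]_d) :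
  dot u v <= enorm u * enorm v.
Proof.
have [u0|un0] := eqVneq (enorm u) 0.
  by rewrite u0 mul0r (enorm0_eq0 _ u0) dot0l.
have [v0|vn0] := eqVneq (enorm v) 0.
  by rewrite v0 mulr0 (enorm0_eq0 _ v0) dotC dot0l.
have := sqr_ge0 (enorm (enorm v *: u - enorm u *: v)).
rewrite -dotvv !(dotDl, dotDr, dotNl, dotNr, dotZl, dotZr) !dotvv (dotC v u).
have a0 : 0 < enorm u by rewrite lt_def un0 enorm_ge0.
have b0 : 0 < enorm v by rewrite lt_def vn0 enorm_ge0.
move: (enorm u) (enorm v) (dot u v) a0 b0 => a b c a0 b0 h.
have ab0 : 0 < a * b by exact: mulr_gt0.
rewrite -(ler_pM2l ab0); nra.
Qed.

Lemma enormD {R : realType} {d : nat} (u v : 'rV[R]_d) :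
  enorm (u + v) <= enorm u + enorm v.
Proof.
rewrite -(@ler_pXn2r _ 2) ?nnegrE ?addr_ge0 ?enorm_ge0//.
rewrite -dotvv !(dotDl, dotDr) !dotvv (dotC v u).
have := dot_le_enorm u v; lra.
Qed.

Lemma enormZ {R : realType} {d : nat} (a : R) (u : 'rV[R]_d) :
  0 <= a -> enorm (a *: u) = a * enorm u.
Proof.
move=> a0; apply/eqP; rewrite -(@eqrXn2 _ 2) ?mulr_ge0 ?enorm_ge0//.
by rewrite exprMn -!dotvv dotZl dotZr mulrA -expr2.
Qed.

Lemma enorm_le_coord {R : realType} {d : nat} (r : R) (u : 'rV[R]_d) :
  0 <= r -> (forall i, `|u ord0 i| <= r) -> enorm u <= d%:R * r.
Proof.
move=> r0 ur; rewrite -(@ler_pXn2r _ 2) ?nnegrE ?mulr_ge0 ?enorm_ge0//.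
rewrite -dotvv; apply: (@le_trans _ _ (\sum_(i < d) r ^+ 2)).
  by apply: ler_sum => i _; rewrite -expr2 -real_normK ?num_real// lerXn2r ?nnegrE.
(* The sum is [d * r ^+ 2], and [d <= d ^ 2] for every natural [d]. *)
rewrite sumr_const card_ord exprMn -[leLHS]mulr_natl ler_wpM2r ?sqr_ge0//.
by rewrite -natrX ler_nat; case: (d) => // n; rewrite expnS leq_pmulr.
Qed.

(** * Gradients of convex functions *)

Lemma derive_dot_grad {R : realType} {d : nat} (f : 'rV[R]_d -> R) x v :
  differentiable f x -> 'D_v f x = dot v (grad f x).
Proof.
move=> df; rewrite deriveE// [v in LHS]row_sum_delta linear_sum/=.
by apply: eq_bigr => i _; rewrite linearZ/= mxE deriveE.
Qed.


(** By convexity, the difference quotient of [f] at [x] along [y - x] with step [t] in (0, 1) is at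
    most [f y - f x]; let [t] tend to 0. *)
Lemma convex_grad_le {R : realType} {d : nat} (f : 'rV[R]_d -> R) x y :
  convex_fun f -> differentiable f x -> dot (y - x) (grad f x) <= f y - f x.
Proof.
move=> cf df; rewrite -derive_dot_grad//.
have cvgf : cvg ((fun h : R => h^-1 *: ((f \o shift x) (h *: (y - x)) - f x))
    @ 0^')%classic by exact: diff_derivable.
(* The bound on the quotient is for positive steps, so the derivative is read as a limit from the
   right. *)
rewrite [leLHS](cvg_at_rightE (fun h : R => h^-1 *: ((f \o shift x) _ - f x)))//.
apply: limr_le.
  rewrite -(cvg_at_rightE (fun h : R => h^-1 *: ((f \o shift x) _ - f x)))//.
  apply: cvg_trans cvgf; apply: cvg_app => B [e e0 Be].
  by exists e => // t te t0; apply: Be => //; exact: lt0r_neq0.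
near=> t.
have t0 : 0 < t by [].
have t1 : t < 1 by near: t; exact: nbhs_right_lt.
rewrite -[leLHS]/(t^-1 * _) ler_pdivrMl//=.
rewrite (_ : t *: (y - x) + x = t *: y + (1 - t) *: x); last first.
  by rewrite scalerBr scalerBl scale1r -addrA [- _ + _]addrC.
have := cf y x t; rewrite (ltW t0) (ltW t1) => /(_ isT); lra.
Unshelve. all: by end_near.
Qed.

(** Add the tangent inequalities at [x] and at [y]. *)
Lemma convex_grad_monotone {R : realType} {d : nat} (f : 'rV[R]_d -> R) x y :
  convex_fun f -> differentiable f x -> differentiable f y ->
  dot (y - x) (grad f x) <= dot (y - x) (grad f y).
Proof.
move=> cf dx dy; have := convex_grad_le f x y cf dx.
have := convex_grad_le f y x cf dy.
rewrite -(opprB y x) dotNl; lra.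
Qed.

(** * Polynomial growth of [V] *)

Lemma is_derive_ray {R : realType} {d : nat} (f : 'rV[R]_d -> R) x (t : R) :
  differentiable f (t *: x) ->
  is_derive t 1 (fun s => f (s *: x)) (dot x (grad f (t *: x))).
Proof.
move=> df; rewrite -derive_dot_grad//.
have E : (fun h : R => h^-1 *: (((fun s => f (s *: x)) \o shift t) (h *: 1)
    - f (t *: x))) = (fun h => h^-1 *: ((f \o shift (t *: x)) (h *: x) - f (t *: x))).
  by apply/funext => h; rewrite /= [h *: 1]mulr1 scalerDl.
have dfx : derivable f (t *: x) x by exact: diff_derivable.
by split; [rewrite /derivable E|rewrite /derive E].
Qed.

(** On the segment from 0 to [x], the function [ln (V (t *: x)) - A * ln (1 + enorm x * t)] is
    nonincreasing; compare its values at 0 and 1 and exponentiate. *)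
Lemma growth_of_log_gradient {R : realType} {d : nat} (V : 'rV[R]_d -> R) (A : R) :
  (forall x, differentiable V x) -> (forall x, 0 < V x) ->
  (forall x, enorm (grad V x) / V x <= A / (1 + enorm x)) ->
  forall x, V x <= V 0 * (1 + enorm x) `^ A.
Proof.
move=> dV V0 hA x; set n := enorm x.
have n0 : 0 <= n := enorm_ge0 x.
have pos (t : R) : 0 <= t -> 0 < 1 + n * t by move=> t0; rewrite ltr_pwDl// mulr_ge0.
pose h t := ln (V (t *: x)) - A * ln (1 + n * t).
pose h' t := (V (t *: x))^-1 * dot x (grad V (t *: x)) - A * ((1 + n * t)^-1 * n).
have hd (t : R) : 0 <= t -> is_derive t 1 h (h' t).
  move=> t0; have ? := is_derive_ray V x t (dV _).
  have ? := is_derive1_ln (V0 (t *: x)).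
  have ? := is_derive1_ln (pos t t0).
  have H1 : is_derive t 1 (fun t => ln (V (t *: x)))
      ((V (t *: x))^-1 * dot x (grad V (t *: x))).
    exact: (@is_derive1_comp _ (@ln R) (fun s => V (s *: x))).
  have H2 : is_derive t 1 (fun t => 1 + n * t) n.
    by apply: is_derive_eq; rewrite add0r mul1r; exact: mulr1.
  have H3 : is_derive t 1 (fun t => ln (1 + n * t)) ((1 + n * t)^-1 * n).
    exact: (@is_derive1_comp _ (@ln R) (fun s => 1 + n * s)).
  exact: (is_deriveB H1 (is_deriveZ A H3)).
have h'0 (t : R) : 0 <= t -> h' t <= 0.
  (* Cauchy-Schwarz and the hypothesis at [t *: x] bound the derivative of [ln (V (t *: x))] by
     [A * n / (1 + n * t)], which is the derivative of the second term. *)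
  move=> t0; rewrite subr_le0 mulrA.
  have := hA (t *: x); rewrite enormZ// -/n ler_pdivrMr// => H.
  rewrite mulrC ler_pdivrMr//; apply: le_trans (dot_le_enorm _ _) _.
  rewrite -/n -mulrA [n * _]mulrC mulrA [n * t]mulrC mulrAC.
  exact: ler_wpM2r.
have : h 1 <= h 0.
  apply: (@ler0_derive1_nincr _ h 0 1) => //.
  - by move=> t /andP[]; rewrite !bnd_simp => /ltW /hd [].
  - move=> t /andP[]; rewrite !bnd_simp => /ltW t0 _.
    by rewrite derive1E; have [_ ->] := hd t t0; exact: h'0.
  - apply: derivable_within_continuous => t /andP[]; rewrite !bnd_simp => t0 _.
    by have [] := hd t t0.
rewrite /h scale1r scale0r mulr1 mulr0 addr0 ln1 mulr0 subr0 lerBlDr -ln_powR -lnM.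
- by rewrite ler_ln// posrE ?mulr_gt0// powR_gt0// -[n]mulr1 pos.
- by rewrite posrE.
- by rewrite posrE powR_gt0// -[n]mulr1 pos.
Qed.

(** * Exponential moments of a Gaussian density *)

Lemma coord_le_enorm {R : realType} {d : nat} (v : 'rV[R]_d) i : `|v ord0 i| <= enorm v.
Proof.
rewrite -sqrtr_sqr ler_sqrt; last by apply: sumr_ge0 => j _; exact: sqr_ge0.
rewrite (bigD1 i)//= lerDl; apply: sumr_ge0 => j _; exact: sqr_ge0.
Qed.

Lemma quad_form_le {R : realType} {d : nat} (S : 'M[R]_d) (v : 'rV[R]_d) :
  dot (v *m S) v <= (\sum_j \sum_i `|S i j|) * enorm v ^+ 2.
Proof.
rewrite mulr_suml; apply: ler_sum => j _.
rewrite mxE !mulr_suml; apply: ler_sum => i _.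
apply: le_trans (ler_norm _) _; rewrite !normrM expr2 -[leLHS]mulrA [leLHS]mulrCA.
by rewrite ler_wpM2l// ler_pM// coord_le_enorm.
Qed.

Lemma spd_unitmx {R : realType} {d : nat} (S : 'M[R]_d) : spd S -> S \in unitmx.
Proof.
move=> [_ S0]; rewrite unitmxE unitfE; apply/negP => /det0P[v v0 vS].
by have := S0 v v0; rewrite vS mul0mx mxE ltxx.
Qed.

(* Positivity of [S] at [w *m invmx S - L^-1 *: w]. *)
Lemma spd_inv_ge {R : realType} {d : nat} (S : 'M[R]_d) (L : R) (w : 'rV[R]_d) :
  spd S -> 0 < L -> (forall v, dot (v *m S) v <= L * enorm v ^+ 2) ->
  enorm w ^+ 2 / L <= (w *m invmx S *m w^T) ord0 ord0.
Proof.
move=> spdS L0 SL; have [symS posS] := spdS; have uS := spd_unitmx S spdS.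
set t := L^-1; set u := w *m invmx S.
have uSw : u *m S = w by rewrite mulmxKV.
have wSu : dot (w *m S) u = enorm w ^+ 2.
  rewrite -dotvv !dot_mx trmx_mul trmx_inv symS mulmxA.
  by rewrite -[w *m S *m _]mulmxA mulmxV// mulmx1.
have psd v : 0 <= dot (v *m S) v.
  have [->|v0] := eqVneq v 0; first by rewrite dotC dot0l.
  by rewrite dot_mx; apply/ltW/posS.
have := psd (u - t *: w); rewrite mulmxBl -scalemxAl uSw.
rewrite !(dotDl, dotDr, dotNl, dotNr, dotZl, dotZr) wSu dotvv -dot_mx (dotC u).
have tL : t * L = 1 by rewrite mulVf// gt_eqF.
have t0 : 0 < t by rewrite invr_gt0.
have := ler_wpM2l (ltW (mulr_gt0 t0 t0)) (SL w).
rewrite [X in _ <= X](_ : _ = t * enorm w ^+ 2); last first.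
  by rewrite -[RHS]mul1r -tL; ring.
lra.
Qed.

(** The integrand is dominated by a constant times a product of one-dimensional normal densities
    centred at the coordinates of [m], whose integral [iint_prod] computes. *)
Lemma gaussian_exp_moment {R : realType} {d : nat} (g : 'rV[R]_d -> R) :
  is_gaussian_density g ->
  [/\ forall z, 0 <= g z & exists a B : R, [/\ 0 < a, 0 < B &
    (iint (fun z => (expR (a * enorm z ^+ 2) * g z)%:E) <= B%:E)%E]].
Proof.
move=> [m [S [spdS ->]]].
have g0 z : 0 <= gauss_density m S z.
  by rewrite mulr_ge0 ?expR_ge0// invr_ge0 sqrtr_ge0.
split=> //.
pose L : R := \sum_j \sum_i `|S i j| + 1.
have L0 : 0 < L by rewrite ltr_wpDl// sumr_ge0// => j _; rewrite sumr_ge0.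
have SL v : dot (v *m S) v <= L * enorm v ^+ 2.
  apply: le_trans (quad_form_le S v) _.
  by rewrite ler_wpM2r ?sqr_ge0// lerDl.
(* With [w = z - m], the density decays at least like [expR (- enorm w ^+ 2 / (2 * L))]. Half of
   this decay pays for the exponential weight; the other half is the profile of a normal law of
   variance [2 * L]. *)
pose s : R := Num.sqrt (2 * L).
have s0 : s != 0 by rewrite gt_eqF// sqrtr_gt0 mulr_gt0.
have s2 : s ^+ 2 = 2 * L by rewrite sqr_sqrtr// mulr_ge0// ltW.
pose K : R := (Num.sqrt ((2 * pi) ^+ d * \det S))^-1 *
  expR (enorm m ^+ 2 / (4 * L)) / normal_peak s ^+ d.
have K0 : 0 <= K.
  apply: mulr_ge0; last by rewrite invr_ge0 exprn_ge0 ?normal_peak_ge0.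
  by apply: mulr_ge0; rewrite ?expR_ge0// invr_ge0 sqrtr_ge0.
(* As [enorm (w + m) ^+ 2 <= 2 * enorm w ^+ 2 + 2 * enorm m ^+ 2], this weight costs at most
   [enorm w ^+ 2 / (4 * L)], plus the term in [m] stored in [K]. Adding 1 to [K] makes the bound
   positive. *)
exists (8 * L)^-1, (K + 1); split.
- by rewrite invr_gt0 mulr_gt0.
- by rewrite ltr_wpDl.
(* Each 1 in the product is the total mass of a normal density, so that [iint_prod] can be used from
   right to left. *)
have -> : K + 1 = K * \prod_(i < d) 1 + 1 by rewrite big1// mulr1.
rewrite EFinD -(@iint_prod _ _ (fun i => normal_pdf (m ord0 i) s))//; last 3 first.
- by move=> i t; exact: normal_pdf_ge0.
- by move=> i; exact: measurable_normal_pdf.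
- by move=> i; exact: integral_normal_pdf.
apply: (@le_trans _ _ _ _ _ _ (leeDl _ _)); last by rewrite lee_fin.
apply: le_iint => z; rewrite lee_fin; first by rewrite mulr_ge0 ?expR_ge0.
have : z = (z - m) + m by rewrite subrK.
move: (z - m) => w zE.
have -> : \prod_i normal_pdf (m ord0 i) s (z ord0 i) =
    normal_peak s ^+ d * expR (- (enorm w ^+ 2 / (4 * L))).
  under eq_bigr do rewrite normal_pdfE//.
  rewrite big_split/= prodr_const card_ord; congr (_ * _).
  rewrite -expR_sum; congr expR; rewrite -dotvv mulr_suml -sumrN.
  apply: eq_bigr => i _; rewrite zE !mxE addrK s2 mulNr -expr2; congr (- (_ / _)); ring.
rewrite /K [leRHS]mulrA divfK; last by rewrite expf_neq0// gt_eqF// normal_peak_gt0.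
rewrite /gauss_density mulrCA -!mulrA ler_wpM2l ?invr_ge0 ?sqrtr_ge0//.
rewrite -!expRD ler_expR zE addrK.
have := spd_inv_ge S L w spdS L0 SL.
move: (_ ord0 ord0) => q Hq.
have : enorm (w + m) ^+ 2 <= 2 * enorm w ^+ 2 + 2 * enorm m ^+ 2.
  have := sqr_ge0 (enorm (w - m)).
  rewrite -!dotvv !(dotDl, dotDr, dotNl, dotNr) (dotC m w); lra.
have i0 : 0 < L^-1 by rewrite invr_gt0.
move: Hq; rewrite !invfM => Hq Hz.
have := ler_wpM2l (ltW i0) Hz; lra.
Qed.

(** * Lower bounds on a cube *)

(** [f] dominates [c] times the indicator of the cube, a product of indicators of intervals of
    length [2 * r]. *)
Lemma iint_ge_box {R : realType} {d : nat} (f : 'rV[R]_d -> R) (x : 'rV[R]_d)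
    (r c : R) :
  0 <= r -> 0 <= c -> (forall y, 0 <= f y) ->
  (forall y : 'rV[R]_d, (forall i, `|y ord0 i - x ord0 i| <= r) -> c <= f y) ->
  ((c * (2 * r) ^+ d)%:E <= iint (fun y => (f y)%:E))%E.
Proof.
move=> r0 c0 f0 fc.
have -> : (2 * r) ^+ d = \prod_(i < d) (2 * r) by rewrite prodr_const card_ord.
pose I i : set R := `[x ord0 i - r, x ord0 i + r]%classic.
rewrite -(@iint_prod _ _ (fun i => \1_(I i)))//; first last.
- move=> i; rewrite integral_indic//=; last exact: measurable_itv.
  rewrite setIT lebesgue_measure_itv/= lte_fin.
  by case: ltP => h; rewrite -?EFinD; congr EFin; lra.
- by move=> i; apply: measurable_indic; exact: measurable_itv.
apply: le_iint => y; rewrite lee_fin.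
  by rewrite mulr_ge0// prodr_ge0.
have [yx|/existsNP[i /negP yx]] := pselect (forall i, `|y ord0 i - x ord0 i| <= r).
  rewrite big1 ?mulr1; first exact: fc.
  move=> i _; rewrite indicE mem_set//= /I/= in_itv/= -ler_distl; exact: yx.
rewrite (bigD1 i)//= indicE memNset ?mul0r ?mulr0//=.
by rewrite /I/= in_itv/= -ler_distl; apply/negP.
Qed.

Lemma continuous_enorm_sq {R : realType} {d : nat} :
  continuous (fun z : 'rV[R]_d => enorm z ^+ 2).
Proof.
have -> : (fun z : 'rV[R]_d => enorm z ^+ 2) =
    (fun z => \sum_(i < d) z ord0 i * z ord0 i).
  by apply/funext => z; rewrite -dotvv.
apply: continuous_big => [|i _ z]; first exact: add_continuous.
by apply: (@cvgM _ _ (nbhs z)); exact: (@coord_continuous R 1 d ord0 i z).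
Qed.

(** Write [y - x = e + p] with [e] the unit vector along [T x] and [enorm p <= 1/4]. With
    [M = enorm (T x)], the product of [y - x] with [T x] is at least [3M/4]; by monotonicity so is
    its product with [T y], which is at most [5/4 * enorm (T y)]. Hence [enorm (T y) >= 3M/5]. *)
Lemma monotone_norm_ge_half {R : realType} {d : nat} (T : 'rV[R]_d -> 'rV[R]_d)
    (x y : 'rV[R]_d) (r : R) :
  (forall x y, dot (y - x) (T x) <= dot (y - x) (T y)) ->
  0 < enorm (T x) -> 0 <= r -> d%:R * r <= 4^-1 ->
  (forall i, `|y ord0 i - (x + (enorm (T x))^-1 *: T x) ord0 i| <= r) ->
  enorm y <= enorm x + 2 /\ enorm (T x) / 2 <= enorm (T y).
Proof.
move=> monoT; set M := enorm (T x) => M0 r0 dr yr.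
set e := M^-1 *: T x.
have e1 : enorm e = 1 by rewrite enormZ ?invr_ge0 ?ltW// mulVf// gt_eqF.
set p := y - (x + e).
have p4 : enorm p <= 4^-1.
  by apply: le_trans dr; apply: enorm_le_coord => // i; move: (yr i); rewrite !mxE.
have yE : y = x + (e + p) by rewrite /p addrA addrC subrK.
have ep : enorm (e + p) <= 5 / 4.
  by apply: le_trans (enormD _ _) _; rewrite e1; lra.
split; first by rewrite yE; apply: le_trans (enormD _ _) _; lra.
have := monoT x y; rewrite (_ : y - x = e + p); last first.
  by rewrite yE addrAC subrr add0r.
have eT : dot e (T x) = M.
  by rewrite dotZl dotvv -/M expr2 mulrA mulVf ?mul1r// gt_eqF.
have pT : - (M / 4) <= dot p (T x).
  have := dot_le_enorm (- p) (T x); rewrite dotNl -/M.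
  have -> : enorm (- p) = enorm p.
    by apply/eqP; rewrite -(@eqrXn2 _ 2) ?enorm_ge0// -!dotvv dotNl dotNr opprK.
  have := ler_wpM2r (ltW M0) p4; lra.
rewrite dotDl eT.
have := dot_le_enorm (e + p) (T y).
have := ler_wpM2r (enorm_ge0 (T y)) ep; lra.
Qed.

(** * Comparison of the two sides of the transport identity *)

Theorem theorem2p2 (R : realType) (d : nat) (hd : (0 < d)%N)
  (g : 'rV[R]_d -> R) (V : 'rV[R]_d -> R)
  (hg : is_gaussian_density g)
  (hV : C11loc V)
  (hVlow : exists c : R, 0 < c /\ forall x, c <= V x)
  (hVint : iint (fun x => ((V x) ^- d)%:E) = 1%E)
  (A : R) (hA : 0 < A)
  (hgradV : forall x, enorm (grad V x) / V x <= A / (1 + enorm x))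
  (T : 'rV[R]_d -> 'rV[R]_d)
  (hT : monotone_transport T (fun x => (V x) ^- d) g) :
  exists C : R, 0 < C /\
    forall x, enorm (T x) <= C * Num.sqrt (1 + ln (1 + enorm x)).
Proof.
have [dV _] := hV; have [[phi [cphi [dphi Tphi]]] push] := hT.
have [g0 [a [B [a0 B0 gB]]]] := gaussian_exp_moment g hg.
have V0 x : 0 < V x by case: hVlow => c [c0 cV]; exact: lt_le_trans (cV x).
have growth := growth_of_log_gradient V A dV V0 hgradV.
have monoT x y : dot (y - x) (T x) <= dot (y - x) (T y).
  by rewrite !Tphi; exact: convex_grad_monotone.
have d0 : 0 < d%:R :> R by rewrite ltr0n.
(* Half the side of the cube, chosen so that [d%:R * r] is exactly 1/4. *)
pose r : R := (4 * d%:R)^-1.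
have r0 : 0 < r by rewrite invr_gt0 mulr_gt0.
have dr : d%:R * r <= 4^-1.
  by rewrite /r invfM mulrCA mulfV ?mulr1// gt_eqF.
(* The logarithm of the final inequality [K * c * (2 * r) ^+ d <= B] reads [a * M ^+ 2 / 4 <= k0 +
   d%:R * A * ln (1 + n)], whose right side is at most [D * (1 + ln (1 + n))]. *)
pose k0 := ln B + d%:R * ln (V 0) + d%:R * A * ln 3 - d%:R * ln (2 * r).
pose D := `|k0| + d%:R * A + 1.
have D0 : 0 < D by rewrite ltr_wpDl// addr_ge0// mulr_ge0// ltW.
have C0 : 0 < 4 * D / a by rewrite divr_gt0// mulr_gt0.
exists (Num.sqrt (4 * D / a)); split=> [|x]; first by rewrite sqrtr_gt0.
set n := enorm x; have n0 : 0 <= n := enorm_ge0 x.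
have n1 : 0 < 1 + n by rewrite ltr_pwDl.
have L0 : 0 <= ln (1 + n) by rewrite ln_ge0// lerDl.
rewrite -sqrtrM; last exact: ltW.
set M := enorm (T x).
have [M0|M0] := leP M 0; first exact: le_trans (sqrtr_ge0 _).
rewrite -(gtr0_norm M0) -[leLHS]sqrtr_sqr ler_sqrt; last first.
  by apply: mulr_ge0; [exact: ltW|exact: addr_ge0].
(* A lower bound for [V ^- d] on the cube: there [enorm y <= n + 2], so
   [1 + enorm y <= 3 * (1 + n)]. *)
pose c := (V 0 * (3 * (1 + n)) `^ A) ^- d.
have W0 : 0 < V 0 * (3 * (1 + n)) `^ A.
  by rewrite mulr_gt0// powR_gt0// mulr_gt0.
have c0 : 0 < c by rewrite invr_gt0 exprn_gt0.
have lnc : ln c = - (d%:R * (ln (V 0) + A * (ln 3 + ln (1 + n)))).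
  rewrite /c lnV ?posrE ?exprn_gt0// lnXn// -[_ *+ d]mulr_natl.
  by rewrite lnM ?posrE ?powR_gt0 ?mulr_gt0// ln_powR lnM ?posrE.
pose K := expR (a * (M / 2) ^+ 2).
(* Truncation makes the test function bounded, as [pushes_forward] requires; the level [K] is its
   value wherever [enorm z >= M / 2], hence at [T y] for every [y] in the cube. *)
pose u (z : 'rV[R]_d) := Num.min (expR (a * enorm z ^+ 2)) K.
have u0 z : 0 <= u z by rewrite le_min !expR_ge0.
have cu : continuous u.
  move=> z; apply: (@continuous_min _ _ (fun z => expR (a * enorm z ^+ 2)) (cst K)).
    apply: continuous_comp; last exact: continuous_expR.
    by apply: (@cvgM _ _ (nbhs z)); [exact: cvg_cst|exact: continuous_enorm_sq].
  exact: cst_continuous.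
have uK : exists M, forall z, u z <= M.
  by exists K => z; rewrite ge_min lexx orbT.
have pushu := push u cu u0 uK.
have upper : (iint (fun z => (u z * g z)%:E) <= B%:E)%E.
  apply: le_trans gB; apply: le_iint => z; rewrite lee_fin ?mulr_ge0//.
  by rewrite ler_wpM2r// ge_min lexx.
have lower : ((K * c * (2 * r) ^+ d)%:E <=
    iint (fun y => (u (T y) * (V y) ^- d)%:E))%E.
  apply: (iint_ge_box _ (x + M^-1 *: T x)); first exact: ltW.
  - by rewrite mulr_ge0 ?expR_ge0// ltW.
  - by move=> y; rewrite mulr_ge0// invr_ge0 exprn_ge0// ltW.
  move=> y yr.
  have [yn TM] := monotone_norm_ge_half T x y r monoT M0 (ltW r0) dr yr.
  apply: ler_pM; [exact: expR_ge0|exact: ltW| |].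
    rewrite le_min lexx andbT ler_expR ler_wpM2l ?(ltW a0)//.
    by rewrite lerXn2r ?nnegrE ?enorm_ge0// divr_ge0// ltW.
  rewrite lef_pV2 ?posrE ?exprn_gt0// lerXn2r ?nnegrE ?(ltW (V0 y)) ?(ltW W0)//.
  apply: le_trans (growth y) _; rewrite ler_wpM2l ?(ltW (V0 0))//.
  apply: ge0_ler_powR; rewrite ?(ltW hA) ?nnegrE ?addr_ge0 ?enorm_ge0 ?mulr_ge0 ?(ltW n1)//.
  move: yn; rewrite -/n; lra.
have : K * c * (2 * r) ^+ d <= B.
  by rewrite -lee_fin; apply: le_trans lower _; rewrite pushu.
have r2 : 0 < 2 * r by rewrite mulr_gt0.
have K0 : 0 < K := expR_gt0 _.
rewrite -ler_ln ?posrE ?mulr_gt0 ?exprn_gt0//.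
rewrite !lnM ?posrE ?mulr_gt0 ?exprn_gt0// lnXn// -[_ *+ d]mulr_natl expRK lnc => H.
have dA : 0 <= d%:R * A by rewrite mulr_ge0// ltW.
have k0L : 0 <= `|k0| * ln (1 + n) by exact: mulr_ge0.
have {}H : a * M ^+ 2 <= 4 * (D * (1 + ln (1 + n))).
  have := ler_norm k0; rewrite /D; move: H; rewrite /k0; nra.
by rewrite mulrAC ler_pdivlMr// mulrC -mulrA.
Qed.
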